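(* Let $G$ be a finite simple undirected connected graph whose blocks are $B_1,\ldots,B_k$. Then the spanning tree auxiliary graph of $G$ is (up to isomorphism) the Cartesian product of the spanning tree auxiliary graphs of its blocks: \[ Aux(G)=Aux(B_1)\,\Box\,\cdots\,\Box\, Aux(B_k). \]
   Context: For a finite simple connected graph $G$ on $n$ vertices, the spanning tree auxiliary graph $Aux(G)$ is the graph whose vertices are the spanning trees of $G$, two spanning trees being adjacent if and only if one is obtained from the other by a single unit transformation, i.e. by adding one edge of $G$ not in the tree and deleting a different edge so that the result is again a spanning tree; equivalently, the symmetric difference of their edge sets has exactly two edges (they share exactly $n-2$ of their $n-1$ edges). A graph is 2-connected if it cannot be disconnected by deleting fewer than two vertices (so it is connected, and $K_2$ counts as 2-connected). A block of $G$ is a maximal 2-connected subgraph of $G$. The Cartesian product $G_1\Box G_2$ of $G_1=(V_1,E_1)$ and $G_2=(V_2,E_2)$ has vertex set $V_1\times V_2$, with $(u_1,u_2)$ adjacent to $(v_1,v_2)$ iff ($u_1=v_1$ and $u_2v_2\in E_2$) or ($u_1v_1\in E_1$ and $u_2=v_2$); it is extended iteratively to several factors. *)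

(* Defs.v *)
From HB Require Import structures.
From mathcomp Require Import all_boot.
Set Implicit Arguments.
Unset Strict Implicit.
Unset Printing Implicit Defensive.

(* A simple graph is a set of vertices, taken in an ambient finite type V,    *)
(* and a set of edges, which are 2-element sets of vertices. The vertex set   *)
(* need not be all of V, so that all subgraphs of a graph live in one type.   *)
Definition simple_edges (V : finType) (p : {set V} * {set {set V}}) : bool :=
  [forall e in p.2, (e \subset p.1) && (#|e| == 2)].

Record graph (V : finType) := Graph {
  graph_val : {set V} * {set {set V}};
  _ : simple_edges graph_val }.

HB.instance Definition _ (V : finType) := [isSub for @graph_val V].
HB.instance Definition _ (V : finType) := [Finite of graph V by <:].

Section Graphs.
Variable V : finType.
Implicit Types (G H B T : graph V) (S : {set V}) (r : rel V).

Definition verts G : {set V} := (graph_val G).1.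
Definition edges G : {set {set V}} := (graph_val G).2.
Definition adj G : rel V := [rel x y | [set x; y] \in edges G].

Lemma adj_irrefl G : irreflexive (adj G).
Proof.
move=> x; apply/negP => xG; have /forall_inP/(_ _ xG) := valP G.
by rewrite setUid cards1 andbF.
Qed.

(* The graph with vertex set S in which distinct x and y are adjacent when    *)
(* r x y or r y x; below r is always symmetric and irreflexive on S.          *)
Definition rel_edges S r : {set {set V}} :=
  [set [set x; y] | x in S, y in S & (x != y) && r x y].

Fact rel_edges_simple S r : simple_edges (S, rel_edges S r).
Proof.
apply/forall_inP => e /imset2P[x y xS].
rewrite inE => /and3P[yS xy _] ->.
by rewrite cards2 xy subUset !sub1set xS yS.
Qed.

Definition rel_graph S r : graph V := Graph (rel_edges_simple S r).

Lemma adj_rel_graph S r x y :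
  {in S &, symmetric r} -> {in S, irreflexive r} ->
  adj (rel_graph S r) x y = [&& x \in S, y \in S & r x y].
Proof.
move=> r_sym r_irr; apply/imset2P/and3P => [[u v uS]|[xS yS rxy]].
  rewrite inE => /and3P[vS uv ruv] Exy.
  have: x \in [set u; v] by rewrite -Exy set21.
  have: y \in [set u; v] by rewrite -Exy set22.
  have: u \in [set x; y] by rewrite Exy set21.
  have: v \in [set x; y] by rewrite Exy set22.
  rewrite !inE => /orP[]/eqP Ev /orP[]/eqP Eu _ _; subst u v.
  - by rewrite eqxx in uv.
  - by split; rewrite // r_sym.
  - by [].
  - by rewrite eqxx in uv.
exists x y => //; rewrite inE yS rxy andbT /=.
by apply: contraTneq rxy => ->; rewrite r_irr.
Qed.

Definition subgraph H G : bool :=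
  (verts H \subset verts G) && (edges H \subset edges G).

Fact delete_simple G S :
  simple_edges (verts G :\: S, [set e in edges G | [disjoint e & S]]).
Proof.
apply/forall_inP => e /=; rewrite inE => /andP[eG eS].
have /forall_inP/(_ e eG)/andP[eV ->] := valP G.
by rewrite subsetD eV eS.
Qed.

Definition delete G S : graph V := Graph (delete_simple G S).

Definition disconnected G : bool :=
  [exists x in verts G, exists y in verts G, ~~ connect (adj G) x y].

Definition connected G : bool := (verts G != set0) && ~~ disconnected G.

(* The empty graph is not disconnected, so K_1 and K_2 are 2-connected. K_1   *)
(* is a block of a connected graph G only when G is itself K_1.               *)
Definition two_connected G : bool :=
  (verts G != set0) &&
  [forall S : {set V},
     (S \subset verts G) && (#|S| < 2) ==> ~~ disconnected (delete G S)].

Definition block G B : bool :=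
  [&& subgraph B G, two_connected B &
      [forall H : graph V,
         [&& subgraph H G, two_connected H & subgraph B H] ==> (H == B)]].

(* The lengths of cycles are bounded only to make the predicate boolean, see  *)
(* acyclicP.                                                                  *)
Definition acyclic G : bool :=
  [forall n : 'I_#|V|.+1, forall c : n.-tuple V,
     (2 < n) ==> ~~ ucycleb (adj G) c].

Lemma acyclicP G :
  reflect (forall c : seq V, 2 < size c -> ~ ucycle (adj G) c) (acyclic G).
Proof.
apply: (iffP forallP) => [acG c c_gt2 cyc | acG n]; last first.
  apply/forallP => c; apply/implyP => n_gt2; apply/negP => cyc.
  by apply: (acG c) => //; rewrite size_tuple.
have cV : size c < #|V|.+1.
  by case/andP: cyc => _ /card_uniqP <-; rewrite ltnS max_card.
have /forallP/(_ (in_tuple c))/implyP/(_ c_gt2)/negP := acG (Ordinal cV).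
exact.
Qed.

Definition tree G : bool := connected G && acyclic G.

Definition spanning_tree G T : bool :=
  [&& subgraph T G, verts T == verts G & tree T].

Definition unit_transformation G : rel (graph V) := fun T1 T2 =>
  [exists e in edges G :\: edges T1, exists f in edges T1,
     edges T2 == (e |: edges T1) :\ f].

End Graphs.

Definition aux (V : finType) (G : graph V) : graph (graph V) :=
  rel_graph [set T | spanning_tree G T] (unit_transformation G).

Lemma adj_aux (V : finType) (G T1 T2 : graph V) :
  adj (aux G) T1 T2 =
    [&& spanning_tree G T1, spanning_tree G T2 & unit_transformation G T1 T2].
Proof.
rewrite adj_rel_graph ?inE // => [|T].
  suff sym T T' : spanning_tree G T ->
      unit_transformation G T T' -> unit_transformation G T' T.
    by move=> T T'; rewrite !inE => hT hT'; apply/idP/idP; apply: sym.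
  case/and3P=> /andP[_ /subsetP TG] _ _ /exists_inP[e].
  rewrite inE => /andP[eT eG] /exists_inP[f fT /eqP ET'].
  have ef : e != f by apply: contraNneq eT => ->.
  apply/exists_inP; exists f; first by rewrite ET' !inE eqxx /= TG.
  apply/exists_inP; exists e; first by rewrite ET' !inE eqxx ef.
  apply/eqP/setP => g; rewrite ET' !inE.
  case: (eqVneq g e) => [->|_] /=; first exact: negbTE.
  by case: eqVneq => [->|].
move=> _; apply/negbTE/negP => /exists_inP[e]; rewrite inE => /andP[eT _].
move=> /exists_inP[f fT /eqP/setP/(_ f)].
by rewrite !inE eqxx fT.
Qed.

Definition cartesian (V1 V2 : finType) (G1 : graph V1) (G2 : graph V2) :
    graph (V1 * V2)%type :=
  rel_graph (setX (verts G1) (verts G2))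
    [rel u v | (u.1 == v.1) && adj G2 u.2 v.2
            || adj G1 u.1 v.1 && (u.2 == v.2)].

Lemma adj_cartesian (V1 V2 : finType) (G1 : graph V1) (G2 : graph V2) u v :
  adj (cartesian G1 G2) u v =
    [&& u \in setX (verts G1) (verts G2), v \in setX (verts G1) (verts G2) &
        (u.1 == v.1) && adj G2 u.2 v.2 || adj G1 u.1 v.1 && (u.2 == v.2)].
Proof.
rewrite adj_rel_graph // => [x y _ _|x _] /=.
  by rewrite eq_sym [x.2 == _]eq_sym /adj /= setUC [[set x.1; _]]setUC.
by rewrite !eqxx andbT !adj_irrefl.
Qed.

Record fgraph := FGraph { ambient : finType; fgraph_graph : graph ambient }.

Definition fcartesian (F1 F2 : fgraph) : fgraph :=
  FGraph (cartesian (fgraph_graph F1) (fgraph_graph F2)).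

(* ((F_1 [] F_2) [] ...) [] F_k; the empty product is K_1. *)
Definition iter_cartesian (Fs : seq fgraph) : fgraph :=
  if Fs is F :: Fs' then foldl fcartesian F Fs'
  else FGraph (rel_graph [set: unit] [rel _ _ | false]).

Definition isomorphic (V W : finType) (G : graph V) (H : graph W) : Prop :=
  exists2 f : {x | x \in verts G} -> {y | y \in verts H},
    bijective f & forall x y, adj H (val (f x)) (val (f y)) = adj G (val x) (val y).

(* Main.v *)
Require Import Defs.
From HB Require Import structures.
From mathcomp Require Import all_boot.

Set Implicit Arguments.
Unset Strict Implicit.
Unset Printing Implicit Defensive.

(** The isomorphism sends a spanning tree T of G to the family of its traces
    T :&: B on the blocks B.

    Everything rests on one property of blocks. The union of two 2-connected
    graphs with two common vertices is 2-connected ([two_connected_union]), so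
    by maximality a block contains every 2-connected subgraph of G that meets
    it in two vertices ([block_absorb]). As K_2 is 2-connected, every edge of G
    lies in exactly one block ([edge_in_block], [block_unique]); as cycles are
    2-connected, a cycle of G with one edge in a block has all its edges there
    ([block_cycle]).

    - The trace of T on B is a spanning tree of B: if an edge of B is not in T,
      the path of T joining its ends closes it to a cycle, so this path lies in
      B ([restrict_spanning_tree]).
    - Conversely, the union of spanning trees of the blocks is a spanning tree
      of G: a cycle in it would lie in one block, hence in the tree chosen for
      that block, and it joins the ends of every edge of G because it does so
      inside the block of that edge ([glue_spanning_tree]).
    - A unit transformation of T that adds e also removes an edge f of the block
      B of e. Otherwise the trace on B would strictly grow, whereas no spanning
      tree strictly contains another ([spanning_tree_eq]). Hence the trace on B
      undergoes a unit transformation and the other traces do not change, which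
      is adjacency in the Cartesian product ([adj_aux_blocks]).

    The iterated product is handled through coordinates
    ([iter_cartesian_coordinatized]): its vertices are families indexed by the
    blocks, and adjacent families are those that differ in one coordinate, by
    an edge of the corresponding factor. *)

(** * Simple graphs and connection *)

Section GraphTheory.
Variable V : finType.
Implicit Types (G H B T : graph V) (S : {set V}) (E : {set {set V}}).

Lemma graph_eq G H : verts G = verts H -> edges G = edges H -> G = H.
Proof.
move=> eqv eqe; apply: val_inj; move: eqv eqe; rewrite /verts /edges /=.
by case: (graph_val G) (graph_val H) => [a b] [c d] /= -> ->.
Qed.

Lemma edge_sub_verts G e : e \in edges G -> e \subset verts G.
Proof. by move=> eG; case/andP: (forall_inP (valP G) e eG). Qed.

Lemma edge_ends G e :
  e \in edges G -> exists x y, [/\ x != y, e = [set x; y] & adj G x y].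
Proof.
move=> eG; case/andP: (forall_inP (valP G) e eG) => _ /cards2P[x [y [xy Ee]]].
by exists x, y; rewrite /adj /= -Ee.
Qed.

Lemma adj_sym G : symmetric (adj G).
Proof. by move=> x y; rewrite /adj /= setUC. Qed.

Lemma adj_verts G x y : adj G x y -> (x \in verts G) /\ (y \in verts G).
Proof. by move/edge_sub_verts; rewrite subUset !sub1set => /andP. Qed.

Lemma adj_neq G x y : adj G x y -> x != y.
Proof. by apply: contraTneq => ->; rewrite adj_irrefl. Qed.

Lemma subgraph_adj H G : subgraph H G -> subrel (adj H) (adj G).
Proof. by case/andP => _ /subsetP sHG x y; apply: sHG. Qed.

Lemma subgraph_refl G : subgraph G G.
Proof. by rewrite /subgraph !subxx. Qed.

Lemma subgraph_trans : transitive (@subgraph V).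
Proof.
move=> H G K /andP[v1 e1] /andP[v2 e2].
by rewrite /subgraph (subset_trans v1) ?(subset_trans e1).
Qed.

Lemma connect_adj_sym G : connect_sym (adj G).
Proof. by apply: sym_connect_sym; apply: adj_sym. Qed.

Lemma not_disconnectedP G :
  reflect {in verts G &, forall x y, connect (adj G) x y} (~~ disconnected G).
Proof.
apply: (iffP idP) => [nd x y xG yG | conn].
  by apply: contraR nd => nxy; apply/exists_inP; exists x => //;
    apply/exists_inP; exists y.
by apply/negP => /exists_inP[x xG] /exists_inP[y yG]; rewrite conn.
Qed.

Lemma adj_delete G S x y :
  adj (delete G S) x y = [&& adj G x y, x \notin S & y \notin S].
Proof.
by rewrite /adj /= inE -setI_eq0 setIUl setU_eq0 !setI_eq0 !disjoints1.
Qed.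

(** The deleted set need not lie in the graph: this frees the proofs below, in
    particular for unions, where S may meet only one of the two graphs, from
    tracking where S lies. *)
Lemma two_connectedP G :
  reflect (verts G != set0 /\ forall S, #|S| < 2 ->
             {in verts G :\: S &, forall x y, connect (adj (delete G S)) x y})
          (two_connected G).
Proof.
apply: (iffP andP) => [[G0 /forallP conn] | [G0 conn]]; split => //.
  move=> S S2.
  have SG2 : #|S :&: verts G| < 2
    by rewrite (leq_ltn_trans _ S2) ?subset_leq_card ?subsetIl.
  have /implyP := conn (S :&: verts G); rewrite subsetIr SG2.
  move=> /(_ isT)/not_disconnectedP cG x y.
  rewrite !inE => /andP[xS xG] /andP[yS yG].
  have := cG x y; rewrite !inE !negb_and xS yS xG yG => /(_ isT isT).
  apply: connect_sub => u v; rewrite adj_delete => /and3P[uv uS vS].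
  have [uG vG] := adj_verts uv.
  apply: connect1; rewrite adj_delete uv.
  by move: uS vS; rewrite !inE uG vG !andbT => -> ->.
apply/forallP => S; apply/implyP => /andP[_ S2].
by apply/not_disconnectedP; apply: conn.
Qed.

Lemma two_connected_connect G :
  two_connected G -> {in verts G &, forall x y, connect (adj G) x y}.
Proof.
case/two_connectedP => _ conn x y xG yG.
have := conn set0; rewrite cards0 setD0 => /(_ isT x y xG yG).
apply: connect_sub => u v; rewrite adj_delete => /and3P[uv _ _].
exact: connect1.
Qed.

(** * Building 2-connected graphs *)

Fact graph_union_simple G H :
  simple_edges (verts G :|: verts H, edges G :|: edges H).
Proof.
apply/forall_inP => e /=; rewrite inE => /orP[eG|eH].
  case/andP: (forall_inP (valP G) e eG) => eV ->.
  by rewrite (subset_trans eV) ?subsetUl.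
case/andP: (forall_inP (valP H) e eH) => eV ->.
by rewrite (subset_trans eV) ?subsetUr.
Qed.

Definition graph_union G H : graph V := Graph (graph_union_simple G H).

Lemma subgraph_unionl G H : subgraph G (graph_union G H).
Proof. by rewrite /subgraph !subsetUl. Qed.

Lemma subgraph_unionr G H : subgraph H (graph_union G H).
Proof. by rewrite /subgraph !subsetUr. Qed.

Lemma subgraph_union G H K :
  subgraph G K -> subgraph H K -> subgraph (graph_union G H) K.
Proof.
by case/andP=> vG eG /andP[vH eH]; rewrite /subgraph !subUset vG vH eG eH.
Qed.

Lemma subgraph_delete G H S : subgraph G H -> subgraph (delete G S) (delete H S).
Proof.
case/andP=> vGH /subsetP eGH; rewrite /subgraph setSD //=.
by apply/subsetP => e; rewrite !inE => /andP[/eGH -> ->].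
Qed.

Lemma connect_subgraph G H x y :
  subgraph G H -> connect (adj G) x y -> connect (adj H) x y.
Proof.
by move=> sGH; apply: connect_sub => u v /(subgraph_adj sGH); apply: connect1.
Qed.

(** Deleting at most one vertex spares one of the two common vertices, through
    which all the remaining ones are joined. *)
Lemma two_connected_union G H x y :
    two_connected G -> two_connected H -> x != y ->
    x \in verts G :&: verts H -> y \in verts G :&: verts H ->
  two_connected (graph_union G H).
Proof.
case/two_connectedP => G0 cG /two_connectedP[_ cH] xy xGH yGH.
apply/two_connectedP; split.
  by apply/set0Pn; exists x; move: xGH; rewrite !inE => /andP[->].
move=> S S2.
have [z zGH zS] : exists2 z, z \in verts G :&: verts H & z \notin S.
  have [xS|xS] := boolP (x \in S); last by exists x.
  exists y => //; apply: contraL S2 => yS.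
  by rewrite -leqNgt (leq_trans _ (subset_leq_card (_ : [set x; y] \subset S)))
    ?cards2 ?xy // subUset !sub1set xS yS.
have to_z u : u \in verts (graph_union G H) :\: S ->
    connect (adj (delete (graph_union G H) S)) u z.
  move: zGH; rewrite !inE => /andP[zG zH] /andP[uS /orP[uG|uH]].
    apply: (@connect_subgraph (delete G S)).
      exact/subgraph_delete/subgraph_unionl.
    by apply: cG => //; rewrite inE ?uS ?zS.
  apply: (@connect_subgraph (delete H S)).
    exact/subgraph_delete/subgraph_unionr.
  by apply: cH => //; rewrite inE ?uS ?zS.
move=> u v /to_z uz /to_z vz; apply: connect_trans uz _.
by rewrite connect_adj_sym.
Qed.

Definition induced G S : graph V := delete G (~: S).

Lemma adj_induced G S x y :
  adj (induced G S) x y = [&& adj G x y, x \in S & y \in S].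
Proof. by rewrite adj_delete !inE !negbK. Qed.

Lemma subgraph_induced G S : subgraph (induced G S) G.
Proof.
rewrite /subgraph subsetDl /=.
by apply/subsetP => e; rewrite inE => /andP[].
Qed.

(** The condition on H bears only on the edges of G between vertices of the
    path, so that H can be a subgraph, a deletion or a block containing them. *)
Lemma connect_along_path G H x p :
    path (adj G) x p ->
    {in x :: p &, forall u v, adj G u v -> adj H u v} ->
  {in x :: p &, forall u v, connect (adj H) u v}.
Proof.
move=> pathp GH.
have pathH : path (adj H) x p.
  move: pathp; apply: (sub_in_path (P := mem (x :: p))) => //; exact/allP.
move=> u v up vp; apply: (@connect_trans _ _ x).
  by rewrite connect_adj_sym; apply: path_connect up.
exact: path_connect vp.
Qed.

Lemma cycle_verts G c : cycle (adj G) c -> {subset c <= verts G}.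
Proof.
move=> cyc x xc; have [] := @adj_verts G x (next c x) => //.
exact: next_cycle.
Qed.

(** A cycle minus one vertex is a path. The subgraph induced on the vertices of
    the cycle replaces the cycle itself: it is as easily seen to be 2-connected
    and needs no description of its edges. The cycle [:: x; y] is allowed and
    yields K_2. *)
Lemma cycle_two_connected G c x :
  x \in c -> ucycle (adj G) c -> two_connected (induced G [set z in c]).
Proof.
move=> xc /andP[cyc uc]; apply/two_connectedP; split.
  by apply/set0Pn; exists x; rewrite !inE negbK xc (cycle_verts cyc).
move=> S S2 u w; rewrite !inE !negbK => /and3P[uS uc' _] /and3P[wS wc _].
have [x0 [p [pathp up wp inp]]] : exists x0 p,
  [/\ path (adj G) x0 p, u \in x0 :: p, w \in x0 :: p &
      {in x0 :: p, forall z, (z \in c) && (z \notin S)}].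
  (* If S misses c, the path is c cut open anywhere; otherwise S is a single
     vertex v, and the path is c rotated to start at v, without v. *)
  have [/hasP[v vc vS] | /hasPn cS] := boolP (has (mem S) c); last first.
    case: c cyc uc cS xc uc' wc => // x0 p /= cyc _ cS _ uc' wc.
    exists x0, p; split=> //.
      by move: cyc; rewrite rcons_path => /andP[].
    by move=> z zp; rewrite zp cS.
  have ES z : z \in S -> z = v.
    by move=> zS; apply/eqP; apply: contraLR S2 => zv; rewrite -leqNgt;
      apply: leq_trans (subset_leq_card (_ : [set z; v] \subset S));
      rewrite ?cards2 ?zv // subUset !sub1set zS.
  have uv : u != v by apply: contraNneq uS => ->.
  have wv : w != v by apply: contraNneq wS => ->.
  case: (rot_to vc) => i q Eq.
  move: uc' wc cyc uc; rewrite -!(mem_rot i c) -(rot_cycle i) -(rot_uniq i) Eq.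
  rewrite !inE (negPf uv) (negPf wv) /= => uq wq cyc /andP[vq _].
  case: q Eq uq wq cyc vq => // x0 p Eq uq wq /=.
  rewrite rcons_path => /and3P[_ pathp _] vp; exists x0, p; split=> // z zp.
  rewrite -(mem_rot i) Eq inE zp orbT /=.
  by apply: contraNN vp => /ES <-.
apply: (connect_along_path pathp) up wp => a b ap bp ab.
rewrite adj_delete adj_induced ab !inE.
by have /andP[-> ->] := inp a ap; have /andP[-> ->] := inp b bp.
Qed.

(** * Blocks *)

Lemma block_subgraph G B : block G B -> subgraph B G.
Proof. by case/and3P. Qed.

Lemma block_two_connected G B : block G B -> two_connected B.
Proof. by case/and3P. Qed.

Lemma block_max G B H :
  block G B -> subgraph H G -> two_connected H -> subgraph B H -> H = B.
Proof.
case/and3P => _ _ /forallP/(_ H)/implyP maxB HG cH BH.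
by apply/eqP/maxB; rewrite HG cH.
Qed.

(** The union of B and H is 2-connected, hence equal to B by maximality. *)
Lemma block_absorb G B H x y :
    block G B -> subgraph H G -> two_connected H -> x != y ->
    x \in verts B :&: verts H -> y \in verts B :&: verts H ->
  subgraph H B.
Proof.
move=> blB HG cH xy xBH yBH.
have EB : graph_union B H = B.
  apply: (block_max blB); last exact: subgraph_unionl.
    by apply: subgraph_union => //; apply: block_subgraph.
  exact: two_connected_union (block_two_connected blB) cH xy xBH yBH.
by rewrite -[in X in is_true X]EB subgraph_unionr.
Qed.

Lemma block_unique G B B' e :
  block G B -> block G B' -> e \in edges B -> e \in edges B' -> B = B'.
Proof.
move=> blB blB' eB eB'; have [x [y [xy Ee xyB]]] := edge_ends eB.
have xyB' : adj B' x y by rewrite /adj /= -Ee.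
have [xB yB] := adj_verts xyB; have [xB' yB'] := adj_verts xyB'.
apply: (block_max blB').
- exact: block_subgraph.
- exact: block_two_connected blB.
apply: (block_absorb blB (block_subgraph blB') (block_two_connected blB') xy).
  by rewrite inE xB.
by rewrite inE yB.
Qed.

(** The ends of an edge of B on the cycle are two vertices shared by B and the
    2-connected subgraph induced on the cycle, which B therefore absorbs. *)
Lemma block_cycle G B c x y :
    block G B -> ucycle (adj G) c -> x \in c -> y \in c -> adj B x y ->
  {in c &, forall u v, adj G u v -> adj B u v}.
Proof.
move=> blB cyc xc yc xyB u v uc vc uv.
have [xB yB] := adj_verts xyB.
have cG : {subset c <= verts G} by apply: cycle_verts; case/andP: cyc.
have sCB : subgraph (induced G [set z in c]) B.
  apply: (block_absorb blB (subgraph_induced _ _) (cycle_two_connected xc cyc)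
            (adj_neq xyB)); by rewrite !inE ?xB ?yB ?xc ?yc cG.
by apply: (subgraph_adj sCB); rewrite adj_induced uv !inE uc.
Qed.

Lemma two_connected_in_block G H :
  subgraph H G -> two_connected H -> exists2 B, block G B & subgraph H B.
Proof.
move=> HG cH.
(* A 2-connected subgraph above H that maximizes the number of vertices and
   edges is maximal for inclusion. *)
pose P K := [&& subgraph K G, two_connected K & subgraph H K].
have PH : P H by rewrite /P HG cH subgraph_refl.
case: (@arg_maxnP _ H P (fun K => #|verts K| + #|edges K|) PH).
move=> B /and3P[BG cB HB] maxB.
exists B => //; apply/and3P; split=> //.
apply/forallP => K; apply/implyP => /and3P[KG cK BK].
have {}maxB : #|verts K| + #|edges K| <= #|verts B| + #|edges B|.
  by apply: maxB; rewrite /P KG cK (subgraph_trans HB BK).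
case/andP: BK => vBK eBK.
have lv := subset_leq_card vBK; have le := subset_leq_card eBK.
apply/eqP/esym/graph_eq; apply/eqP.
  rewrite eqEcard vBK -(leq_add2r #|edges B|).
  by apply: leq_trans maxB; rewrite leq_add2l.
rewrite eqEcard eBK -(leq_add2l #|verts B|).
by apply: leq_trans maxB; rewrite leq_add2r.
Qed.

(** An edge is a K_2, and so extends to a block. *)
Lemma edge_in_block G e :
  e \in edges G -> exists2 B, block G B & e \in edges B.
Proof.
case/edge_ends=> x [y [xy -> xyG]].
have cyc : ucycle (adj G) [:: x; y].
  by rewrite /ucycle /= inE xy andbT [in adj G y x]adj_sym xyG.
have [//||B blB sB] := @two_connected_in_block G (induced G [set z in [:: x; y]]).
- exact: subgraph_induced.
- by apply: cycle_two_connected cyc; apply: mem_head.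
exists B => //; apply: (subgraph_adj sB).
by rewrite adj_induced xyG !inE !eqxx orbT.
Qed.

(** * Spanning trees of a graph and of its blocks *)

Fact spanning_subgraph_simple G E : simple_edges (verts G, edges G :&: E).
Proof.
apply/forall_inP => e; rewrite inE => /andP[eG _].
exact: (forall_inP (valP G)).
Qed.

(** E may contain edges from outside G. This serves both to cut a tree down to
    a block and to glue trees of the blocks together. *)
Definition spanning_subgraph G E : graph V :=
  Graph (spanning_subgraph_simple G E).

Lemma spanning_subgraph_sub G E : subgraph (spanning_subgraph G E) G.
Proof. by rewrite /subgraph subxx subsetIl. Qed.

Lemma adj_spanning_subgraph G E x y :
  adj (spanning_subgraph G E) x y = adj G x y && ([set x; y] \in E).
Proof. by rewrite /adj /= inE. Qed.

Lemma sub_ucycle (r r' : rel V) c :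
  {in c &, subrel r r'} -> ucycle r c -> ucycle r' c.
Proof.
move=> rr' /andP[cyc uc]; rewrite /ucycle uc andbT.
by move: cyc; apply: (sub_in_cycle (P := mem c)) => //; apply/allP.
Qed.

Lemma spanning_treeP G T :
  reflect [/\ subgraph T G, verts T = verts G, verts T != set0,
              {in verts T &, forall x y, connect (adj T) x y} &
              forall c, 2 < size c -> ~ ucycle (adj T) c]
          (spanning_tree G T).
Proof.
apply: (iffP and3P) => [[sTG /eqP vT] | [sTG vT T0 cT acT]].
  by case/andP=> /andP[T0 /not_disconnectedP cT] /acyclicP acT; split.
split=> //; first exact/eqP.
by rewrite /tree /connected T0; apply/andP; split;
  [apply/not_disconnectedP | apply/acyclicP].
Qed.

(** The path p of T closes up to a cycle through the edge [set x; y], which is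
    its step from the last vertex back to the first. *)
Lemma fundamental_cycle G T x y :
    subgraph T G -> adj G x y -> ~~ adj T x y -> connect (adj T) x y ->
  exists p, [/\ path (adj T) x p, last x p = y, 1 < size p &
    ucycle (adj G) (x :: p)].
Proof.
move=> sTG xyG xyT /connectP[p0 /shortenP[p pathp up _] Ey].
exists p; split=> //.
  case: p pathp up Ey => [|z [|z' p]] //= pathp _ Ey.
    by move: xyG; rewrite Ey adj_irrefl.
  by move: xyT pathp; rewrite Ey => /negPf ->.
rewrite /ucycle up andbT /= rcons_path -Ey adj_sym xyG andbT.
exact: sub_path (subgraph_adj sTG) _ _ pathp.
Qed.

(** An edge of T' outside T would close a cycle in T' with the path of T that
    joins its ends. *)
Lemma spanning_tree_eq G T T' :
    spanning_tree G T -> spanning_tree G T' -> edges T \subset edges T' ->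
  T = T'.
Proof.
case/spanning_treeP=> _ vT _ cT _ /spanning_treeP[_ vT' _ _ acT'] sTT'.
apply: graph_eq; first by rewrite vT.
apply/eqP; rewrite eqEsubset sTT'; apply/subsetP => e eT'.
have [x [y [_ Ee xyT']]] := edge_ends eT'; have [xT' yT'] := adj_verts xyT'.
apply: contraT => eT; have xyT : ~~ adj T x y by rewrite /adj /= -Ee.
have sub : subgraph T T' by rewrite /subgraph vT vT' subxx.
have [|p [_ _ p1 cyc]] := fundamental_cycle sub xyT' xyT.
  by apply: cT; rewrite vT -vT'.
by case: (acT' (x :: p)).
Qed.

(** B is connected, so it suffices to join the ends of each edge xy of B. If xy
    is not in T, then T joins x to y by a path that forms a cycle with xy, and
    this cycle stays in B. *)
Lemma restrict_spanning_tree G B T :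
    spanning_tree G T -> block G B ->
  spanning_tree B (spanning_subgraph B (edges T)).
Proof.
case/spanning_treeP=> sTG vT T0 cT acT blB.
have sBG := block_subgraph blB.
apply/spanning_treeP; split=> //.
- exact: spanning_subgraph_sub.
- by case/two_connectedP: (block_two_connected blB).
- move=> x y xB yB; have := two_connected_connect (block_two_connected blB) xB yB.
  apply: connect_sub => {xB yB} {}x {}y xyB.
  have [xyT|xyT] := boolP (adj T x y).
    by apply: connect1; rewrite adj_spanning_subgraph xyB.
  have xyG := subgraph_adj sBG xyB; have [xG yG] := adj_verts xyG.
  have [|p [pathp Ey _ cyc]] := fundamental_cycle sTG xyG xyT.
    by apply: cT; rewrite vT.
  have xp : x \in x :: p by apply: mem_head.
  have yp : y \in x :: p by rewrite -Ey mem_last.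
  apply: (connect_along_path pathp) xp yp => u v up vp uv.
  rewrite adj_spanning_subgraph; apply/andP; split; last exact: uv.
  by apply: (block_cycle blB cyc _ _ xyB) => //;
    rewrite ?mem_head -?Ey ?mem_last //; apply: subgraph_adj sTG _ _ uv.
- move=> c c2 cyc; apply: (acT c c2); move: cyc; apply: sub_ucycle => u v _ _.
  by rewrite adj_spanning_subgraph => /andP[].
Qed.

Section Blocks.
Variables (G : graph V) (Bs : seq (graph V)).
Hypotheses (hG : connected G) (Bs_blocks : forall B, (B \in Bs) = block G B).

Definition glue (w : graph V -> graph V) : graph V :=
  spanning_subgraph G [set e | has (fun B => e \in edges (w B)) Bs].

Variable w : graph V -> graph V.
Hypothesis w_tree : {in Bs, forall B, spanning_tree B (w B)}.

(** Distinct blocks share no edge, so within B only w B contributes to the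
    union. *)
Lemma mem_glue B e :
  B \in Bs -> e \in edges B -> (e \in edges (glue w)) = (e \in edges (w B)).
Proof.
move=> BBs eB; have blB : block G B by rewrite -Bs_blocks.
rewrite !inE; apply/andP/idP => [[_ /hasP[B' B'Bs eB']]|ewB].
  have /spanning_treeP[/andP[_ /subsetP sB'] _ _ _ _] := w_tree B'Bs.
  by rewrite (block_unique blB _ eB (sB' _ eB')) -?Bs_blocks.
split; last by apply/hasP; exists B.
by case/andP: (block_subgraph blB) => _ /subsetP; apply.
Qed.

Lemma glue_restrict B : B \in Bs -> spanning_subgraph B (edges (glue w)) = w B.
Proof.
move=> BBs; have /spanning_treeP[/andP[_ /subsetP sB] vB _ _ _] := w_tree BBs.
apply: graph_eq => //; apply/setP => e; rewrite [LHS]inE.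
have [eB | eB] := boolP (e \in edges B); first exact: mem_glue.
by apply/esym/negbTE; apply: contra eB; apply: sB.
Qed.

(** Edges of G are joined inside their blocks, and a cycle in the union lies in
    a single block, hence in a single tree. *)
Lemma glue_spanning_tree : spanning_tree G (glue w).
Proof.
case/andP: hG => G0 /not_disconnectedP cG.
apply/spanning_treeP; split=> //; first exact: spanning_subgraph_sub.
- move=> x y xG yG; have := cG x y xG yG.
  apply: connect_sub => {xG yG} {}x {}y xyG.
  have [B blB xyB] := edge_in_block xyG; have [xB yB] := adj_verts xyB.
  have BBs : B \in Bs by rewrite Bs_blocks.
  have /spanning_treeP[sB vB _ cB _] := w_tree BBs.
  have := cB x y; rewrite vB xB yB => /(_ isT isT).
  apply: connect_sub => u v uv; apply: connect1.
  by rewrite /adj /= (mem_glue BBs) //; apply: subgraph_adj sB _ _ uv.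
move=> [//|x c] c2 cyc.
have cycG : ucycle (adj G) (x :: c).
  move: cyc; apply: sub_ucycle => u v _ _.
  exact: subgraph_adj (spanning_subgraph_sub _ _) _ _.
pose y := next (x :: c) x.
have xc : x \in x :: c by apply: mem_head.
have yc : y \in x :: c by rewrite mem_next.
have xyG : adj G x y by case/andP: cycG => /next_cycle/(_ xc).
have [B blB xyB] := edge_in_block xyG.
have BBs : B \in Bs by rewrite Bs_blocks.
have /spanning_treeP[_ _ _ _ /(_ _ c2)] := w_tree BBs; apply.
move: cyc; apply: sub_ucycle => u v uc vc uv.
suff uvB : adj B u v by rewrite /adj /= -(mem_glue BBs).
apply: (block_cycle blB cycG xc yc xyB) => //.
exact: subgraph_adj (spanning_subgraph_sub _ _) _ _ uv.
Qed.

End Blocks.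

(** * Unit transformations act within one block *)

Section BlockExchange.
Variables (G : graph V) (Bs : seq (graph V)).
Hypothesis Bs_blocks : forall B, (B \in Bs) = block G B.
Variables T T' : graph V.
Hypotheses (hT : spanning_tree G T) (hT' : spanning_tree G T').

Let res T B := spanning_subgraph B (edges T).

Lemma spanning_tree_blocks_inj : {in Bs, res T =1 res T'} -> T = T'.
Proof.
move=> eqr; apply: spanning_tree_eq hT hT' _; apply/subsetP => e eT.
case/spanning_treeP: hT => /andP[_ /subsetP/(_ e eT) eG] _ _ _ _.
have [B blB eB] := edge_in_block eG.
have BBs : B \in Bs by rewrite Bs_blocks.
have /(congr1 (@edges V))/setP/(_ e) := eqr B BBs.
by rewrite !inE eB eT => /esym.
Qed.

(** If e is added and f removed, then f lies in the block B of e: otherwise the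
    trace on B gains e and loses nothing, which two spanning trees of B do not
    allow. Conversely an exchange in B reads as an exchange in G, because every
    edge of G can be tested in its own block. *)
Lemma adj_aux_blocks :
  adj (aux G) T T' <->
  exists B, [/\ B \in Bs, adj (aux B) (res T B) (res T' B) &
                forall B', B' \in Bs -> B' != B -> res T B' = res T' B'].
Proof.
have treeB B :
    B \in Bs -> spanning_tree B (res T B) /\ spanning_tree B (res T' B).
  by rewrite Bs_blocks => blB; split; apply: restrict_spanning_tree blB.
rewrite adj_aux hT hT' /=; split.
  case/exists_inP => e; rewrite inE => /andP[eT eG] /exists_inP[f fT /eqP ET'].
  have [B blB eB] := edge_in_block eG.
  have BBs : B \in Bs by rewrite Bs_blocks.
  have [tB tB'] := treeB B BBs.
  have fB : f \in edges B.
    apply: contraT => fB.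
    have EB : res T B = res T' B.
      apply: spanning_tree_eq tB tB' _; apply/subsetP => g.
      rewrite !inE => /andP[gB gT]; rewrite gB ET' !inE gT orbT andbT.
      by apply: contraNneq fB => <-.
    have /(congr1 (@edges V))/setP/(_ e) := EB.
    rewrite !inE eB (negPf eT) ET' !inE eqxx /= andbT => /esym/negbFE/eqP Eef.
    by rewrite Eef fT in eT.
  exists B; split=> //.
    rewrite adj_aux tB tB' /=; apply/exists_inP; exists e.
      by rewrite !inE eB (negPf eT).
    apply/exists_inP; exists f; first by rewrite !inE fB fT.
    apply/eqP/setP => g; rewrite !inE ET' !inE.
    case: (eqVneq g e) => [->|_]; first by rewrite eB andbT.
    by rewrite /= andbCA.
  move=> B' B'Bs neB; apply: graph_eq => //; apply/setP => g.
  rewrite !inE ET' !inE.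
  have [gB' /=|//] := boolP (g \in edges B').
  have notB h : h \in edges B -> g != h.
    move=> hB; apply: contraNneq neB => Egh; rewrite -Egh in hB.
    have blB' : block G B' by rewrite -Bs_blocks.
    exact/eqP/esym/(block_unique blB blB' hB gB').
  by rewrite (negPf (notB e eB)) (negPf (notB f fB)).
case=> B [BBs]; rewrite adj_aux => /and3P[_ _ /exists_inP[e]].
have blB : block G B by rewrite -Bs_blocks.
have /andP[_ /subsetP sBG] := block_subgraph blB.
rewrite !inE negb_and => /andP[eT eB]; rewrite eB /= in eT.
case/exists_inP => f; rewrite inE => /andP[fB fT] /eqP/setP EB eqB'.
apply/exists_inP; exists e; first by rewrite inE eT sBG.
apply/exists_inP; exists f => //; apply/eqP/setP => g.
have [gG|gG] := boolP (g \in edges G); last first.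
  have notG h : h \in edges G -> g != h by move=> hG; apply: contraNneq gG => ->.
  rewrite !inE (negPf (notG _ (sBG _ eB))) /=.
  case/spanning_treeP: hT => /andP[_ /subsetP sT] _ _ _ _.
  case/spanning_treeP: hT' => /andP[_ /subsetP sT'] _ _ _ _.
  by rewrite (contraNF (sT g) gG) (contraNF (sT' g) gG) andbF.
have [B' blB' gB'] := edge_in_block gG.
have B'Bs : B' \in Bs by rewrite Bs_blocks.
have [EBB|neB] := eqVneq B' B.
  by subst B'; have := EB g; rewrite !inE gB'.
have notB h : h \in edges B -> g != h.
  move=> hB; apply: contraNneq neB => Egh; rewrite -Egh in hB.
  exact/eqP/(block_unique blB' blB gB' hB).
have /(congr1 (@edges V))/setP/(_ g) := eqB' B' B'Bs neB.
by rewrite !inE gB' (negPf (notB e eB)) (negPf (notB f fB)) /= => ->.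
Qed.

End BlockExchange.
End GraphTheory.

(** * Coordinates on iterated Cartesian products *)

Section Coordinates.
Variables (I : eqType) (W : finType) (H : I -> graph W).
Implicit Types (s : seq I) (w : I -> W).

Definition family_of s w : Prop := {in s, forall i, w i \in verts (H i)}.

Definition one_coordinate s w w' : Prop :=
  exists i, [/\ i \in s, adj (H i) (w i) (w' i) &
                forall j, j \in s -> j != i -> w j = w' j].

(** The type of vertices of an iterated product depends on the list of factors.
    Describing its vertices as images of functions I -> W, which only matter on
    s, keeps this type out of sight and makes the description stable under
    appending a factor. *)
Definition coordinatized (F : Defs.fgraph) s : Prop :=
  exists g : (I -> W) -> ambient F,
  [/\ forall w, family_of s w -> g w \in verts (fgraph_graph F),
      forall x, x \in verts (fgraph_graph F) ->
        exists2 w, family_of s w & g w = x,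
      forall w w', g w = g w' <-> {in s, w =1 w'} &
      forall w w', family_of s w -> family_of s w' ->
        adj (fgraph_graph F) (g w) (g w') <-> one_coordinate s w w'].

(** Products are nested to the left, so the induction appends a factor at the
    end. The function I -> W is there for the empty product, whose single
    vertex has to be the image of some family. *)
Lemma iter_cartesian_coordinatized s :
  (I -> W) -> uniq s ->
  coordinatized (iter_cartesian [seq FGraph (H i) | i <- s]) s.
Proof.
move=> w0; elim/last_ind: s => [_ | s i IHs].
  exists (fun=> tt); split=> //=.
  - by case=> _; exists w0.
  - move=> w w' _ _; split; last by case=> i [].
    by rewrite adj_irrefl.
case: s IHs => [_ _ | j s IHs].
  exists (fun w => w i); split=> /=.
  - by move=> w; apply; apply: mem_head.
  - by move=> x xH; exists (fun=> x) => // k; rewrite inE => /eqP->.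
  - by move=> w w'; split=> [eqw k | ->]; rewrite ?mem_head // inE => /eqP->.
  move=> w w' _ _; split=> [adj_w | [k [ks]]].
    exists i; split=> // [|k]; first exact: mem_head.
    by rewrite inE => /eqP->; rewrite eqxx.
  by move: ks; rewrite inE => /eqP->.
rewrite rcons_uniq => /andP[is_ us].
have [g [gv gs gi ga]] := IHs us.
have -> : iter_cartesian [seq FGraph (H k) | k <- rcons (j :: s) i] =
    fcartesian (iter_cartesian [seq FGraph (H k) | k <- j :: s]) (FGraph (H i)).
  by rewrite map_rcons /= foldl_rcons.
(* Only membership in the extended list matters from here on. *)
have mem_t k : (k \in rcons (j :: s) i) = (k == i) || (k \in j :: s).
  by rewrite mem_rcons inE.
move: (rcons (j :: s) i) mem_t => t mem_t.
have neqi k : k \in j :: s -> k != i by apply: contraTneq => ->.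
have sub_s k : k \in j :: s -> k \in t.
  by move=> ks; rewrite mem_t ks orbT.
have i_s : i \in t by rewrite mem_t eqxx.
have fam_s w : family_of t w -> family_of (j :: s) w.
  by move=> fw k ks; apply: fw (sub_s k ks).
have gv' w : family_of t w ->
    (g w, w i) \in setX
      (verts (fgraph_graph (iter_cartesian [seq FGraph (H k) | k <- j :: s])))
      (verts (H i)).
  by move=> fw; rewrite inE /= gv ?fw //; apply: fam_s.
exists (fun w => (g w, w i)); split=> //.
- case=> x y; rewrite inE => /andP[/= /gs[w fw <-] yH].
  pose w' k := if k == i then y else w k.
  have ww' : {in j :: s, w' =1 w} by move=> k /neqi/negPf ki; rewrite /w' ki.
  exists w'; last by congr (_, _); [apply/gi | rewrite /w' eqxx].
  move=> k; rewrite mem_t => /predU1P[->|ks]; first by rewrite /w' eqxx.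
  by rewrite ww' // fw.
- move=> w w'; split=> [[/gi eqw eqwi] k | eqw].
    by rewrite mem_t => /predU1P[->|/eqw].
  by congr (_, _); [apply/gi => k /sub_s/eqw | apply: eqw].
move=> w w' fw fw'; rewrite adj_cartesian !gv' //=; split.
  case/orP => /andP[].
    move=> /eqP/gi eqw adj_i; exists i; split=> // k.
    by rewrite mem_t => /predU1P[->|/eqw //]; rewrite eqxx.
  case/ga => [||k [ks adj_k eqw] /eqP eqwi]; try exact: fam_s.
  exists k; split=> // [|l]; first exact: sub_s.
  by rewrite mem_t => /predU1P[->|/eqw].
case=> k []; rewrite mem_t => /predU1P[->|ks] adj_k eqw; apply/orP.
  left; rewrite adj_k andbT; apply/eqP/gi => l ls.
  by apply: eqw; [apply: sub_s | apply: neqi].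
right; rewrite (eqw i) // 1?eq_sym ?neqi // eqxx andbT.
apply/ga; try exact: fam_s.
by exists k; split=> // l /sub_s; apply: eqw.
Qed.

End Coordinates.

Theorem theorem3 (V : finType) (G : graph V) (Bs : seq (graph V))
  (hG : connected G)
  (Bs_uniq : uniq Bs)
  (Bs_blocks : forall B : graph V, (B \in Bs) = block G B) :
  isomorphic (aux G)
    (fgraph_graph (iter_cartesian [seq FGraph (aux B) | B <- Bs])).
Proof.
have [g [gv gs gi ga]] := iter_cartesian_coordinatized (@aux V) id Bs_uniq.
set F := iter_cartesian _ in g gv gs gi ga *.
pose res (T : graph V) B := spanning_subgraph B (edges T).
have treeP (T : {T | T \in verts (aux G)}) : spanning_tree G (val T).
  by have := valP T; rewrite inE.
have res_fam (T : {T | T \in verts (aux G)}) :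
    family_of (@aux V) Bs (res (val T)).
  move=> B; rewrite Bs_blocks inE => blB.
  exact: restrict_spanning_tree (treeP T) blB.
pose f (T : {T | T \in verts (aux G)}) : {y | y \in verts (fgraph_graph F)} :=
  Sub (g (res (val T))) (gv _ (res_fam T)).
exists f; last first.
  move=> T T'; rewrite !SubK; apply/idP/idP.
    by move/(ga _ _ (res_fam T) (res_fam T')) => hr;
      apply/(adj_aux_blocks Bs_blocks (treeP T) (treeP T')).
  by move/(adj_aux_blocks Bs_blocks (treeP T) (treeP T')) => hr; apply/ga.
have f_inj : injective f.
  move=> T T' /(congr1 val); rewrite !SubK => /gi eqr; apply: val_inj.
  exact: spanning_tree_blocks_inj Bs_blocks _ _ (treeP T) (treeP T') eqr.
have f_surj y : exists T, f T = y.
  have [w fw gw] := gs _ (valP y).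
  have w_tree : {in Bs, forall B, spanning_tree B (w B)}.
    by move=> B /fw; rewrite inE.
  have tG := glue_spanning_tree hG Bs_blocks w_tree.
  have tG' : glue G Bs w \in verts (aux G) by rewrite inE.
  exists (Sub (glue G Bs w) tG'); apply: val_inj; rewrite !SubK -gw.
  by apply/gi => B BBs; apply: glue_restrict.
have [f' f'K] := fin_all_exists f_surj.
by exists f' => //; apply: inj_can_sym.
Qed.
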